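(* Let $\mathcal{U}$ be a real reflexive Banach space, let $J:\mathcal{U}\to\mathbb{R}$ be Gateaux differentiable, let $\Gamma:\mathcal{U}\to\mathbb{R}^s$ be a bounded linear operator, and let $\{\phi_i\}_{i\ge 1}$ be a complete system in $\mathcal{U}$. Set $\mathring{\mathcal{U}}:=\{u\in\mathcal{U}\mid \Gamma u=0\}$, let $\mathcal{U}^{(N)}$ be the linear span of $\phi_1,\dots,\phi_N$, and set $\mathring{\mathcal{U}}^{(N)}:=\mathcal{U}^{(N)}\cap\mathring{\mathcal{U}}$. Suppose that $J$ is convex and grows at infinity on $\mathring{\mathcal{U}}$. Then $J$ has a minimizer $\overline{u}$ on $\mathring{\mathcal{U}}$, as well as minimizers $u^{(N)}$ on all $\mathring{\mathcal{U}}^{(N)}$, and there exists a subsequence $N_k$ such that $u^{(N_k)}$ converges weakly to $\overline{u}$ as $k\to\infty$. Moreover, if $J$ is strictly convex on $\mathring{\mathcal{U}}$, then $\overline{u}$ and all the $u^{(N)}$ are unique and $u^{(N)}$ converges weakly to $\overline{u}$ as $N\to\infty$. In both cases the values of $J$ along the convergent sequence (that is, $J(u^{(N_k)})$ in the first case and $J(u^{(N)})$ in the second) converge to the minimum of $J$ on $\mathring{\mathcal{U}}$.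
   Context: A system $\{\phi_i\}_{i\ge1}$ of elements of a Banach space is called complete if every element of the space can be approximated in norm to any given precision by finite linear combinations of the $\phi_i$ (i.e. the linear span is dense). $J$ is Gateaux differentiable on $\mathcal{U}$ if at every $u\in\mathcal{U}$ its first variation $\frac{d}{dt}J(u+t\,\delta u)\big|_{t=0}$ exists and is linear and bounded in $\delta u$, thus defining a derivative $J'(u)\in\mathcal{U}^*$. $J$ grows at infinity on a subspace $\mathcal{W}\subseteq\mathcal{U}$ if $J(u)\to\infty$ as $\|u\|\to\infty$ with $u\in\mathcal{W}$. *)

(* Defs.v *)
From HB Require Import structures.
From mathcomp Require Import all_boot all_order all_algebra.
From mathcomp Require Import interval_inference.
From mathcomp Require Import all_classical all_reals all_analysis.

Set Implicit Arguments.
Unset Strict Implicit.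
Unset Printing Implicit Defensive.

Import Order.TTheory GRing.Theory Num.Theory.
Import numFieldNormedType.Exports.

Local Open Scope classical_set_scope.
Local Open Scope ring_scope.

Definition bounded_linear (R : realType) (V W : normedModType R) (f : V -> W) :=
  linear f /\ exists M : R, forall x, `|f x| <= M * `|x|.

Section Dual.
Context {R : realType} {V : normedModType R}.

Definition dual_pred : {pred V -> R^o} :=
  fun f => `[< bounded_linear (f : V -> R^o) >].

Lemma dual_submod_closed : submod_closed dual_pred.
Proof.
split=> [|a f g /asboolP[lf [M fM]] /asboolP[lg [N gN]]]; apply/asboolP; split.
- by move=> b x y /=; rewrite scaler0 addr0.
- by exists 0 => x; rewrite normr0 mul0r.
- move=> b x y; rewrite !fctE lf lg !scalerDr !scalerA (mulrC a b).
  by rewrite addrACA.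
- exists (`|a| * M + N) => x; rewrite !fctE.
  rewrite (le_trans (ler_normD _ _))// mulrDl lerD ?gN//.
  by rewrite normrZ -mulrA ler_wpM2l.
Qed.

HB.instance Definition _ :=
  GRing.isSubmodClosed.Build R (V -> R^o) dual_pred dual_submod_closed.

End Dual.

Record dual (R : realType) (V : normedModType R) := Dual {
  dual_fun :> V -> R^o;
  dual_funP : dual_fun \in dual_pred }.

HB.instance Definition _ (R : realType) (V : normedModType R) :=
  [isSub for @dual_fun R V].
HB.instance Definition _ (R : realType) (V : normedModType R) :=
  [Choice of dual V by <:].
HB.instance Definition _ (R : realType) (V : normedModType R) :=
  [SubChoice_isSubLmodule of dual V by <:].

Section DualNorm.
Context {R : realType} {V : normedModType R}.
Implicit Types f g : dual V.

Definition dual_norm f : R := sup [set `|f x| | x in [set x : V | `|x| <= 1]].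

Lemma dual_linear f : linear (f : V -> R^o).
Proof. by have /asboolP[] := dual_funP f. Qed.

Lemma dualZ f a x : f (a *: x) = a * f x.
Proof.
have f0 : f 0 = 0.
  have := dual_linear f 1 0 0; rewrite !scale1r addr0 => /eqP.
  by rewrite -subr_eq0 opprD addNKr oppr_eq0 => /eqP.
by have := dual_linear f a x 0; rewrite addr0 f0 addr0.
Qed.

Lemma dual_norm_has_sup f :
  has_sup [set `|f x| | x in [set x : V | `|x| <= 1]].
Proof.
have /asboolP[_ [M fM]] := dual_funP f.
split; first by exists `|f 0|, 0; rewrite //= normr0.
exists `|M| => _ [x /= x1 <-]; apply: (le_trans (fM x)).
by rewrite (le_trans (ler_norm _))// normrM ler_piMr// normr_id.
Qed.

Lemma dual_norm_ub f x : `|x| <= 1 -> `|f x| <= dual_norm f.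
Proof.
by move=> x1; apply: (sup_upper_bound (dual_norm_has_sup f)); exists x.
Qed.

Lemma dual_norm_le f M :
  (forall x, `|x| <= 1 -> `|f x| <= M) -> dual_norm f <= M.
Proof.
move=> fM; apply: ge_sup; first by have [] := dual_norm_has_sup f.
by move=> _ [x /= x1 <-]; exact: fM.
Qed.

Lemma dual_normP f x : `|f x| <= dual_norm f * `|x|.
Proof.
have [->|x0] := eqVneq x 0.
  by rewrite -(scale0r 0) dualZ mul0r scale0r !normr0 mulr0.
have nx : 0 < `|x| by rewrite normr_gt0.
rewrite -ler_pdivrMr// mulrC -[X in X * _]gtr0_norm ?invr_gt0// -normrM -dualZ.
by apply: dual_norm_ub; rewrite normrZ gtr0_norm ?invr_gt0// mulVf ?gt_eqF.
Qed.

Lemma dual_norm_ge0 f : 0 <= dual_norm f.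
Proof. by rewrite (le_trans _ (@dual_norm_ub f 0 _)) ?normr0. Qed.

Lemma dual_normD f g : dual_norm (f + g) <= dual_norm f + dual_norm g.
Proof.
apply: dual_norm_le => x x1.
by rewrite (le_trans (ler_normD _ _))// lerD// dual_norm_ub.
Qed.

Let dual_normZ_le a f : dual_norm (a *: f) <= `|a| * dual_norm f.
Proof.
by apply: dual_norm_le => x x1; rewrite normrM ler_wpM2l// dual_norm_ub.
Qed.

Lemma dual_normZ a f : dual_norm (a *: f) = `|a| * dual_norm f.
Proof.
apply/eqP; rewrite eq_le dual_normZ_le /=.
have [->|a0] := eqVneq a 0; first by rewrite normr0 mul0r dual_norm_ge0.
rewrite -ler_pdivlMl ?normr_gt0// -normfV.
by rewrite -[in leLHS](scale1r f) -(mulVf a0) -scalerA dual_normZ_le.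
Qed.

Lemma dual_norm0_eq0 f : dual_norm f = 0 -> f = 0.
Proof.
move=> f0; apply/val_inj/funext => x /=; apply/eqP.
by rewrite -normr_le0 (le_trans (dual_normP f x))// f0 mul0r.
Qed.

HB.instance Definition _ :=
  @Lmodule_isNormed.Build R (dual V) dual_norm dual_normD dual_normZ
    dual_norm0_eq0.

End DualNorm.

Section Statement.
Context {R : realType} {U : normedModType R}.
Implicit Types (J : U -> R) (W : set U) (phi : nat -> U).

(* Surjectivity of the canonical embedding u |-> (f |-> f u) of U in U**. *)
Definition reflexive_space (V : normedModType R) :=
  forall F : dual (dual V), exists u : V, forall f : dual V, F f = f u.

Definition weak_cvg (u_ : nat -> U) (u : U) :=
  forall f : dual U, f (u_ n) @[n --> \oo] --> f u.

Definition gateaux_differentiable J :=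
  forall u : U, (forall v : U, derivable J u v) /\
    bounded_linear ((fun v => 'D_v J u) : U -> R^o).

(* The system phi_1, phi_2, ... is indexed from 0, so this is the span of its
   first N elements phi 0, ..., phi N.-1. *)
Definition span_upto phi (N : nat) : set U :=
  [set \sum_(i < N) a i *: phi i | a in [set: nat -> R]].

Definition complete_system phi := dense (\bigcup_N span_upto phi N).

Definition grows_at_infinity J W :=
  forall M : R, exists r : R, forall u, W u -> r <= `|u| -> M <= J u.

Definition convex_on J W := @convex_function R U W J.

Definition strictly_convex_on J W :=
  forall (t : R) (x y : U), 0 < t < 1 -> W x -> W y -> x != y ->
    J (t *: x + (1 - t) *: y) < t * J x + (1 - t) * J y.

Definition is_minimizer J W (u : U) := W u /\ forall v, W v -> J u <= J v.

End Statement.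

(* Main.v *)
From HB Require Import structures.
Require Import Defs.
From mathcomp Require Import all_boot all_order all_algebra.
From mathcomp Require Import interval_inference.
From mathcomp Require Import ring lra.
From mathcomp Require Import all_classical all_reals all_analysis.

Set Implicit Arguments.
Unset Strict Implicit.
Unset Printing Implicit Defensive.

Import Order.TTheory GRing.Theory Num.Theory.
Import numFieldNormedType.Exports.

Local Open Scope classical_set_scope.
Local Open Scope ring_scope.

(** The existence of minimizers is the direct method of the calculus of variations:
    growth at infinity bounds a minimizing sequence, bounded sequences have weak
    limits ([reflexive_ultra_weak_cvg]; [span_upto_ultra_cvg] in finite dimension),
    and J is weakly lower semicontinuous, since the gradient inequality
    J u + J'(u) (v - u) <= J v bounds it below by affine functionals
    ([gradient_inequality], [minimizing_weak_limit]). Weak limits are taken along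
    ultrafilters on the integers: they exist in one stroke, and a sequence
    converges to l as soon as it does so along every ultrafilter.

    The minimizers u^(N) on the subspaces form a minimizing sequence for J on the
    kernel of Gamma ([galerkin_minimizing]); this gives the convergence of the
    values and makes every weak limit a minimizer. Two ingredients are needed.
    First, the intersections of the spans with the kernel are dense in the
    kernel: [kernel_projection] builds a bounded projection onto the kernel that
    subtracts a combination of finitely many of the phi i, so that it maps large
    spans to themselves. Second, J must be upper semicontinuous on the kernel,
    which Gateaux differentiability does not give: composed with the projection,
    J becomes a lower semicontinuous convex function on a Banach space, and such
    a function is continuous by Baire's theorem ([convex_lsc_usc]).

    A weakly convergent subsequence is extracted from an ultrafilter limit
    ([reflexive_weak_subsequence]): the space is separable, so some countable
    family of functionals has the same annihilator as the whole dual
    ([countable_separating_family]), and it is enough to control the subsequence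
    on this family. In the strictly convex case the minimizer is unique, so all
    weak limits along ultrafilters coincide and the whole sequence converges. *)

(** * Ultrafilters and weak limits *)

(** Of the preimages of a set and of its complement, one belongs to G. *)
Lemma ultra_fmap (S T : Type) (x : S -> T) (G : set_system S) :
  UltraFilter G -> UltraFilter (x @ G).
Proof.
move=> GU; split; first exact: fmap_proper_filter.
move=> H HF xGH; rewrite eqEsubset; split=> [A HA|]; last exact: xGH.
have [//|GnA] := in_ultra_setVsetC (x @^-1` A) GU.
have HnA : H (~` A) by apply: xGH.
by have /filter_ex[? []] : H (A `&` ~` A) by exact: filterI.
Qed.

Lemma ultra_bounded_cvg (R : realType) (T : Type) (G : set_system T)
    (x : T -> R) (r : R) :
  UltraFilter G -> (\forall k \near G, `|x k| <= r) ->
  exists2 l, x @ G --> l & `|l| <= r.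
Proof.
move=> GU xr.
have := @segment_compact R (- r) r; rewrite compact_ultra.
move=> /(_ (x @ G) (ultra_fmap _ GU))[|l [/= lr xl]].
  by apply: filterS xr => k /=; rewrite ler_norml in_itv.
by exists l => //; rewrite ler_norml; move: lr; rewrite in_itv.
Qed.

Section DualArithmetic.
Context {R : realType} {V : normedModType R}.
Implicit Types (f : dual V) (x y : V).

Lemma dualB f x y : f (x - y) = f x - f y.
Proof.
by rewrite -scaleN1r addrC dual_linear addrC scaleN1r.
Qed.

Lemma bounded_linear_dual (g : V -> R^o) :
  bounded_linear g -> exists f : dual V, forall x, f x = g x.
Proof.
by move=> gbl; exists (@Dual R V g (asboolT gbl)).
Qed.

End DualArithmetic.

Definition weak_cvg_along {R : realType} {U : normedModType R}
    (G : set_system nat) (u_ : nat -> U) (u : U) :=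
  forall f : dual U, f (u_ n) @[n --> G] --> f u.

(** Weak compactness of balls, without choosing a subsequence: along an
    ultrafilter all the bounded scalar sequences f (u_ n) converge at once, their
    limits depend on f linearly and boundedly, and reflexivity turns this element
    of the bidual into a vector. *)
Lemma reflexive_ultra_weak_cvg (R : realType) (U : normedModType R)
    (G : set_system nat) (u_ : nat -> U) (r : R) :
  reflexive_space U -> UltraFilter G -> (\forall k \near G, `|u_ k| <= r) ->
  exists u, weak_cvg_along G u_ u.
Proof.
move=> Urefl GU ur.
have /choice[F FP] : forall f : dual U, exists l : R^o,
    f (u_ n) @[n --> G] --> l /\ `|l| <= r * `|f|.
  move=> f; have [|l fl lr] := @ultra_bounded_cvg R nat G
    (fun n => f (u_ n)) (r * `|f|) GU; last by exists l.
  apply: filterS ur => k ukr; rewrite (le_trans (dual_normP f _))//.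
  by rewrite (mulrC r) ler_wpM2l// dual_norm_ge0.
have Fbl : bounded_linear (F : dual U -> R^o).
  split=> [a f g|]; last by exists r => f; have [_] := FP f.
  have [Ffg _] := FP (a *: f + g); apply: (norm_cvg_unique Ffg).
  have [Ff _] := FP f; have [Fg _] := FP g.
  by apply: cvgD; [apply: cvgZl_tmp Ff|exact: Fg].
have [FF FFE] := bounded_linear_dual Fbl.
have [u uE] := Urefl FF.
by exists u => f; rewrite -uE FFE; have [] := FP f.
Qed.

(** A failure of convergence happens on a set of indices that meets every
    element of the filter, and this set belongs to some finer ultrafilter. *)
Lemma cvg_along_ultra (R : realType) (x : nat -> R) (l : R) (F : set_system nat) :
  Filter F ->
  (forall G, UltraFilter G -> F `<=` G -> x @ G --> l) -> x @ F --> l.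
Proof.
move=> FF xG; apply: contrapT => nxl.
have [e e0 ne] : exists2 e : R, 0 < e & ~ (\forall k \near F, `|l - x k| < e).
  apply: contrapT => /forall2NP H; apply: nxl; apply/cvgrPdist_lt => e e0.
  by have [//|/contrapT] := H e.
pose B := [set k | ~ `|l - x k| < e].
have wF : ProperFilter (within B F).
  split; last exact: within_filter.
  rewrite /within /= => W; apply: ne; apply: filterS W => k /= kB.
  by apply: contrapT.
have [G [GU wG]] := ultraFilterLemma wF.
have FG : F `<=` G by move=> A FA; apply: wG; apply: filterS FA.
have GB : G B by apply: wG; apply: (@filterE _ F).
have /cvgrPdist_lt/(_ e e0) Ge := xG G GU FG.
by have /filter_ex[k []] : G ([set k | `|l - x k| < e] `&` B) by exact: filterI.
Qed.

(** * Convex Gateaux differentiable functionals and minimizing sequences *)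

Section ConvexGateaux.
Context {R : realType} {U : normedModType R} (J : U -> R) (W : set U).

Lemma convex_onP (t : R) (x y : U) : convex_on J W -> 0 <= t <= 1 ->
  W x -> W y -> J (t *: x + (1 - t) *: y) <= t * J x + (1 - t) * J y.
Proof.
move=> Jconv /andP[t0 t1] Wx Wy.
by apply: (Jconv (Itv01 t0 t1) x y); rewrite inE.
Qed.

Lemma gateaux_dual (u : U) : gateaux_differentiable J ->
  exists f : dual U, forall v, f v = 'D_v J u.
Proof. by move=> /(_ u)[_ /bounded_linear_dual]. Qed.

(** The difference quotients of J along the segment from u to v are at most
    J v - J u, so their limit is. *)
Lemma gradient_inequality (u v : U) :
  convex_on J W -> derivable J u (v - u) -> W u -> W v ->
  J u + 'D_(v - u) J u <= J v.
Proof.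
move=> Jconv dJ Wu Wv; rewrite leNgt; apply/negP => Jvlt.
pose D := 'D_(v - u) J u; pose c := ((J v - J u) + D) / 2.
have Dlt : J v - J u < D by rewrite ltrBlDl.
have cD : c < D by rewrite /c; lra.
have vc : J v - J u < c by rewrite /c; lra.
have /cvg_dnbhs_at_right /cvgr_ge/(_ c cD) qc := dJ.
near (0 : R)^'+ => h.
have h0 : 0 < h by near: h; exact: nbhs_right_gt.
have h1 : h < 1 by near: h; exact: nbhs_right_lt.
have : c <= h^-1 *: ((J \o shift u) (h *: (v - u)) - J u) by near: h.
rewrite /= leNgt => /negP; apply; apply: le_lt_trans vc.
rewrite -[_ *: _]/(_ * _) mulrC ler_pdivrMr//.
have -> : h *: (v - u) + u = h *: v + (1 - h) *: u.
  by rewrite scalerBr scalerBl scale1r -addrA [- _ + u]addrC.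
have := convex_onP Jconv (_ : 0 <= h <= 1) Wv Wu.
by rewrite (ltW h0) (ltW h1) => /(_ isT); lra.
Unshelve. all: by end_near. Qed.

End ConvexGateaux.

Section Minimizing.
Context {R : realType} {U : normedModType R} (J : U -> R).

(** Comparing with each value J v, rather than with the infimum over V, makes sense
    before J is known to be bounded below on V; and w may run outside V. *)
Definition minimizing_along (G : set_system nat) (V : set U) (w : nat -> U) :=
  forall v e, V v -> 0 < e -> \forall k \near G, J (w k) < J v + e.

Lemma minimizing_alongS (F G : set_system nat) (V : set U) w :
  F `<=` G -> minimizing_along F V w -> minimizing_along G V w.
Proof. by move=> FG wmin v e Vv e0; apply: FG; exact: wmin. Qed.

Lemma minimizing_bounded (G : set_system nat) (W V : set U) w :
  Filter G -> grows_at_infinity J W -> V !=set0 ->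
  (\forall k \near G, W (w k)) -> minimizing_along G V w ->
  exists r, \forall k \near G, `|w k| <= r.
Proof.
move=> GF Jgrows [v Vv] Ww wmin; have [r rP] := Jgrows (J v + 1).
exists r; apply: filterS2 Ww (wmin v 1 Vv ltr01) => k Wk Jk.
by rewrite leNgt; apply/negP => /ltW /(rP _ Wk); rewrite leNgt Jk.
Qed.

(** Weak lower semicontinuity: by the gradient inequality J is bounded below
    by an affine functional with value J u at u, and this functional is weakly
    continuous. *)
Lemma minimizing_weak_limit (G : set_system nat) (W V : set U) w u :
  ProperFilter G -> gateaux_differentiable J -> convex_on J W ->
  (\forall k \near G, W (w k)) -> minimizing_along G V w ->
  W u -> weak_cvg_along G w u -> forall v, V v -> J u <= J v.
Proof.
move=> GF Jdiff Jconv Ww wmin Wu wu v Vv.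
rewrite leNgt; apply/negP => Jvu; pose e := (J u - J v) / 2.
have e0 : 0 < e by rewrite /e; lra.
have [f fE] := gateaux_dual u Jdiff.
have /cvgr_ge fu := wu f.
have fue : f u - e < f u by lra.
have [k [[fk Jk] Wk]] := filter_ex
  (filterI (filterI (fu _ fue) (wmin v e Vv e0)) Ww).
have := gradient_inequality Jconv ((Jdiff u).1 (w k - u)) Wu Wk.
rewrite -fE dualB; move: Jk fk => /=; rewrite /e; lra.
Qed.

Lemma minimizing_sequence (V : set U) : V !=set0 ->
  exists2 w : nat -> U, forall k, V (w k) & minimizing_along \oo V w.
Proof.
move=> [v0 Vv0].
have [Jlb|Jnlb] := pselect (has_lbound [set J v | v in V]).
  have Jinf : has_inf [set J v | v in V] by split=> //; exists (J v0), v0.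
  have /choice[w wP] : forall k : nat, exists x,
      V x /\ J x < inf [set J v | v in V] + k.+1%:R^-1.
    move=> k; have k0 : 0 < k.+1%:R^-1 :> R by rewrite invr_gt0.
    by have [_ [x Vx <-] Jx] := inf_adherent k0 Jinf; exists x.
  exists w => [k|v e Vv e0]; first by have [] := wP k.
  near=> k; have [_ /lt_le_trans->//] := wP k.
  rewrite lerD//; first by apply: (inf_lbound Jlb); exists v.
  by near: k; apply: filterS (near_infty_natSinv_lt (PosNum e0)) => k /ltW.
have /choice[w wP] : forall k : nat, exists x, V x /\ J x < - k%:R.
  move=> k; apply: contrapT => /forallNP nx; apply: Jnlb.
  by exists (- k%:R) => _ [x Vx <-]; rewrite leNgt; apply/negP => Jx; apply: (nx x).
exists w => [k|v e Vv e0]; first by have [] := wP k.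
near=> k; have [_ /lt_trans->//] := wP k.
by rewrite ltrNl; near: k; exact: nbhs_infty_gtr.
Unshelve. all: by end_near. Qed.

(** The direct method. The compactness hypothesis on V can come from reflexivity
    or from finite dimension. *)
Lemma exists_minimizer (W V : set U) :
  gateaux_differentiable J -> convex_on J W -> grows_at_infinity J W ->
  V `<=` W -> V !=set0 ->
  (forall (G : set_system nat) w r, UltraFilter G ->
     (forall k, V (w k)) -> (\forall k \near G, `|w k| <= r) ->
     exists2 u, V u & weak_cvg_along G w u) ->
  exists u, is_minimizer J V u.
Proof.
move=> Jdiff Jconv Jgrows VW V0 Vcompact.
have [w Vw wmin] := minimizing_sequence V0.
have [G [GU ooG]] := ultraFilterLemma (_ : ProperFilter (\oo : set_system nat)).
have Ww : \forall k \near G, W (w k).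
  by apply: (@filterE _ G) => k; exact/VW/Vw.
have Gmin := minimizing_alongS ooG wmin.
have [r wr] := minimizing_bounded _ Jgrows V0 Ww Gmin.
have [u Vu wu] := Vcompact G w r GU Vw wr.
exists u; split=> // v Vv.
by apply: (minimizing_weak_limit _ Jdiff Jconv Ww Gmin (VW _ Vu) wu).
Qed.

End Minimizing.

(** * Spans of finitely many vectors *)

Section Span.
Context {R : realType} {U : normedModType R} (phi : nat -> U).

Lemma span_upto_linear N a x y :
  span_upto phi N x -> span_upto phi N y -> span_upto phi N (a *: x + y).
Proof.
move=> [b _ <-] [c _ <-]; exists (fun i => a * b i + c i) => //.
rewrite scaler_sumr -big_split; apply: eq_bigr => i _ /=.
by rewrite scalerDl scalerA.
Qed.

Lemma span_upto0 N : span_upto phi N 0.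
Proof. by exists (fun=> 0) => //; rewrite big1// => i _; rewrite scale0r. Qed.

Lemma span_uptoZ N a x : span_upto phi N x -> span_upto phi N (a *: x).
Proof.
by move=> /(span_upto_linear a)/(_ (span_upto0 N)); rewrite addr0.
Qed.

Lemma span_uptoD N x y :
  span_upto phi N x -> span_upto phi N y -> span_upto phi N (x + y).
Proof. by move=> /(span_upto_linear 1); rewrite scale1r; apply. Qed.

Lemma span_uptoSP N x : span_upto phi N.+1 x <->
  exists a v, span_upto phi N v /\ x = v + a *: phi N.
Proof.
split=> [[a _ <-]|[a [_ [[b _ <-] ->]]]].
  rewrite big_ord_recr/=; exists (a N), (\sum_(i < N) a i *: phi i).
  by split=> //; exists a.
exists (fun i => if (i < N)%N then b i else a) => //.
rewrite big_ord_recr/= ltnn; congr (_ + _).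
by apply: eq_bigr => i _; rewrite ltn_ord.
Qed.

Lemma subset_span_upto M N : (M <= N)%N -> span_upto phi M `<=` span_upto phi N.
Proof.
move=> /subnK <-; elim: (N - M)%N => [|n IHn]; first by rewrite add0n.
move=> x /IHn xn; rewrite addSn; apply/span_uptoSP.
by exists 0, x; rewrite scale0r addr0.
Qed.

Lemma span_upto_mem i N : (i < N)%N -> span_upto phi N (phi i).
Proof.
move=> /subset_span_upto; apply; apply/span_uptoSP.
by exists 1, 0; rewrite scale1r add0r; split=> //; exact: span_upto0.
Qed.

(** Local compactness of a finite-dimensional subspace, by induction on the number
    of generators. If the new generator is not in the old span, then by the
    induction hypothesis it is at positive distance d from it; hence its
    coefficient along a bounded sequence is bounded, and both components
    converge along the ultrafilter. *)
Lemma span_upto_ultra_cvg N (G : set_system nat) (w : nat -> U) (r : R) :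
  UltraFilter G -> (forall k, span_upto phi N (w k)) ->
  (\forall k \near G, `|w k| <= r) ->
  exists2 v, span_upto phi N v & w @ G --> v.
Proof.
elim: N => [|N IHN] in G w r * => GU wN wr.
  exists 0; first exact: span_upto0.
  suff -> : w = cst 0 by exact: cvg_cst.
  by apply/funext => k; have [a _ <-] := wN k; rewrite big_ord0.
have [phiN|nphiN] := pselect (span_upto phi N (phi N)).
  have [|v vN wv] := IHN G w r GU _ wr.
    move=> k; have /span_uptoSP[a [v [vN ->]]] := wN k.
    by apply: span_uptoD => //; exact: span_uptoZ.
  by exists v => //; exact: subset_span_upto vN.
(* Otherwise some v k in the old span tend to - phi N; by the induction
   hypothesis their limit is in the old span. *)
have [d d0 dP] : exists2 d, 0 < d &
    forall v, span_upto phi N v -> d <= `|v + phi N|.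
  apply: contrapT => /forall2NP nd; apply: nphiN.
  have /choice[v vP] : forall k : nat, exists v,
      span_upto phi N v /\ `|v + phi N| < k.+1%:R^-1.
    move=> k; apply: contrapT => /forallNP nv.
    have [|] := nd k.+1%:R^-1; first by rewrite invr_gt0.
    apply=> v vN; rewrite leNgt; apply/negP => vk.
    exact: (nv v).
  have [H [HU ooH]] := ultraFilterLemma (_ : ProperFilter (\oo : set_system nat)).
  have vphi : v k + phi N @[k --> H] --> 0.
    apply/cvgrPdist_lt => e e0; apply: ooH.
    apply: filterS (near_infty_natSinv_lt (PosNum e0)) => k ke.
    by rewrite sub0r normrN; have [_ /lt_trans->] := vP k.
  have [k||u uN vu] := IHN H v (1 + `|phi N|) HU.
  - by have [] := vP k.
  - apply: filterE => k; have [_ vk] := vP k.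
    rewrite -(addrK (phi N) (v k)) (le_trans (ler_normB _ _))// lerD2r.
    by rewrite (le_trans (ltW vk))// invf_le1// ler1n.
  have : u + phi N = 0 := norm_cvg_unique (cvgD vu (cvg_cst (phi N))) vphi.
  move=> uphi; have -> : phi N = - u by rewrite -(addKr u (phi N)) uphi addr0.
  by rewrite -scaleN1r; exact: span_uptoZ.
have /choice[c cP] : forall k, exists c : R * U,
    span_upto phi N c.2 /\ w k = c.2 + c.1 *: phi N.
  by move=> k; have /span_uptoSP[a [v vP]] := wN k; exists (a, v).
have cr : \forall k \near G, `|(c k).1| <= r / d.
  apply: filterS wr => k; have [ckN ->] := cP k => wr.
  rewrite ler_pdivlMr//; have [->|ck0] := eqVneq (c k).1 0.
    by rewrite normr0 mul0r (le_trans _ wr).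
  apply: le_trans wr.
  have -> : (c k).2 + (c k).1 *: phi N =
      (c k).1 *: ((c k).1^-1 *: (c k).2 + phi N).
    by rewrite scalerDr scalerA mulfV// scale1r.
  by rewrite normrZ ler_wpM2l//; apply: dP; exact: span_uptoZ.
have [a ca _] := ultra_bounded_cvg GU cr.
have [k||v vN cv] := IHN G (fun k => (c k).2) (r + r / d * `|phi N|) GU.
- by have [] := cP k.
- apply: filterS2 wr cr => k wr cr; have [_ wk] := cP k.
  have -> : (c k).2 = w k - (c k).1 *: phi N by rewrite wk addrK.
  by rewrite (le_trans (ler_normB _ _))// lerD// normrZ ler_wpM2r.
exists (v + a *: phi N); first by apply/span_uptoSP; exists a, v.
have -> : w = fun k => (c k).2 + (c k).1 *: phi N.
  by apply/funext => k; have [] := cP k.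
exact: cvgD cv (cvgZr_tmp ca).
Qed.

End Span.

(** * A projection onto the kernel that respects the spans *)

Section BoundedLinear.
Context {R : realType} {V W : normedModType R}.

Let pack_linear (f : V -> W) (lf : linear f) : {linear V -> W} :=
  HB.pack f (GRing.isLinear.Build _ _ _ _ _ lf).

Lemma linear_fun0 (f : V -> W) : linear f -> f 0 = 0.
Proof. by move=> lf; exact: (linear0 (pack_linear lf)). Qed.

Lemma linear_funB (f : V -> W) x y : linear f -> f (x - y) = f x - f y.
Proof. by move=> lf; exact: (linearB (pack_linear lf)). Qed.

Lemma linear_funD (f : V -> W) x y : linear f -> f (x + y) = f x + f y.
Proof. by move=> lf; exact: (linearD (pack_linear lf)). Qed.

Lemma linear_funZ (f : V -> W) a x : linear f -> f (a *: x) = a *: f x.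
Proof. by move=> lf; exact: (linearZZ (pack_linear lf)). Qed.

Lemma linear_fun_comb (f : V -> W) N (a : 'I_N -> R) (x : 'I_N -> V) :
  linear f -> f (\sum_(i < N) a i *: x i) = \sum_(i < N) a i *: f (x i).
Proof.
move=> lf; transitivity (\sum_(i < N) f (a i *: x i)).
  exact: (linear_sum (pack_linear lf)).
by apply: eq_bigr => i _; exact: linear_funZ.
Qed.

Lemma bounded_linear_pos (f : V -> W) : bounded_linear f ->
  exists2 M : R, 0 < M & forall x, `|f x| <= M * `|x|.
Proof.
move=> [_ [M fM]]; exists (`|M| + 1) => [|x]; first by rewrite ltr_wpDl.
by rewrite (le_trans (fM x))// ler_wpM2r// (le_trans (ler_norm M))// lerDl.
Qed.

End BoundedLinear.

Section CompleteSystem.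
Context {R : realType} {U : normedModType R} (phi : nat -> U).

Lemma complete_systemP v e : complete_system phi -> 0 < e ->
  exists N w, span_upto phi N w /\ `|v - w| < e.
Proof.
move=> phic e0; have [| |w [bw [N _ wN]]] := phic (ball v e).
- by exists v; exact: ballxx.
- exact: ball_open.
by exists N, w; split=> //; move: bw; rewrite -ball_normE.
Qed.

Lemma complete_system_eq0 (W : normedModType R) (f : U -> W) :
  complete_system phi -> bounded_linear f -> (forall i, f (phi i) = 0) ->
  forall v, f v = 0.
Proof.
move=> phic fbl fphi v; have [lf _] := fbl.
have [M M0 fM] := bounded_linear_pos fbl.
apply/eqP; rewrite -normr_le0; apply/ler_addgt0Pl => e e0; rewrite addr0.
have [|N [_ [[a _ <-] vw]]] := @complete_systemP v (e / M) phic.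
  by rewrite divr_gt0.
have -> : f v = f (v - \sum_(i < N) a i *: phi i).
  rewrite linear_funB// linear_fun_comb// big1 ?subr0// => i _.
  by rewrite fphi scaler0.
by rewrite (le_trans (fM _))// -ler_pdivlMl// mulrC ltW.
Qed.

End CompleteSystem.

Lemma coord_le_norm (R : realDomainType) (m n : nat) (A : 'M[R]_(m, n)) i j :
  `|A i j| <= mx_norm A.
Proof. by rewrite mx_normrE (le_bigmax _ (fun ij => `|A ij.1 ij.2|) (i, j)). Qed.

Section KernelProjection.
Context {R : realType} {U : normedModType R} (phi : nat -> U).
Context {s : nat} (Gamma : U -> 'rV[R]_s).
Context (Gammabl : bounded_linear Gamma).

Let gamma N : 'M[R]_(N, s) := \matrix_(i < N) Gamma (phi i).

Let sub_gamma i N : (i < N)%N -> (Gamma (phi i) <= gamma N)%MS.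
Proof.
move=> iN; rewrite -(_ : row (Ordinal iN) (gamma N) = Gamma (phi i)) ?row_sub//.
by rewrite rowK.
Qed.

(** The ranks of the matrices gamma N are at most s, so their row spaces cannot
    keep growing. *)
Lemma range_finitely_generated :
  exists N, forall i, (Gamma (phi i) <= gamma N)%MS.
Proof.
apply: contrapT => /forallNP nN.
suff [N] : exists N, (s.+1 <= \rank (gamma N))%N.
  by rewrite leqNgt ltnS rank_leq_col.
elim: s.+1 => [|r [N rN]]; first by exists 0%N.
have /existsNP[i /negP iN] := nN N.
exists (maxn N i.+1); apply: leq_ltn_trans rN _; apply: rank_ltmx.
rewrite ltmxE; apply/andP; split.
  apply/row_subP => j; rewrite rowK sub_gamma//.
  by rewrite leq_max ltn_ord.
apply: contra iN; apply: submx_trans; apply: sub_gamma.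
by rewrite leq_max ltnSn orbT.
Qed.

(** A linear right inverse of Gamma on the row space of gamma N. *)
Let lift N (y : 'rV[R]_s) : U :=
  \sum_(i < N) (y *m pinvmx (gamma N)) 0 i *: phi i.

Let liftK N y : (y <= gamma N)%MS -> Gamma (lift N y) = y.
Proof.
move=> yN; rewrite -[RHS](mulmxKpV yN) mulmx_sum_row.
rewrite linear_fun_comb; last by have [] := Gammabl.
by apply: eq_bigr => i _; rewrite rowK.
Qed.

Let lift_linear N : linear (lift N).
Proof.
move=> a x y; rewrite /lift scaler_sumr -big_split; apply: eq_bigr => i _.
by rewrite mulmxDl -scalemxAl !mxE scalerDl scalerA.
Qed.

Let lift_bounded N : exists M, forall y, `|lift N y| <= M * `|y|.
Proof.
exists (\sum_(i < N) (\sum_j `|pinvmx (gamma N) j i|) * `|phi i|) => y.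
rewrite (le_trans (ler_norm_sum _ _ _))// mulr_suml ler_sum// => i _.
rewrite normrZ mulrAC ler_wpM2r// mxE (le_trans (ler_norm_sum _ _ _))//.
rewrite mulr_suml ler_sum// => j _; rewrite normrM mulrC ler_wpM2l//.
exact: coord_le_norm.
Qed.

(** P v := v - lift (Gamma v). The lift uses finitely many of the phi i, whence
    the last property; that P v is in the kernel need only be checked on the
    vectors phi i, by continuity. *)
Lemma kernel_projection : complete_system phi ->
  exists (P : U -> U) (N0 : nat),
    [/\ bounded_linear P, forall v, Gamma (P v) = 0,
        forall v, Gamma v = 0 -> P v = v
      & forall N v, (N0 <= N)%N -> span_upto phi N v -> span_upto phi N (P v)].
Proof.
move=> phic; have [N0 gN0] := range_finitely_generated.
have [lG [C GC]] := Gammabl; have [M liftM] := lift_bounded N0.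
have [K K0 GK] := bounded_linear_pos Gammabl.
pose P v := v - lift N0 (Gamma v).
have Pbl : bounded_linear P.
  split=> [a x y|].
    by rewrite /P lG lift_linear scalerBr opprD addrACA.
  exists (1 + `|M| * K) => v; rewrite (le_trans (ler_normB _ _))// mulrDl mul1r.
  rewrite lerD2l (le_trans (liftM _))// -mulrA.
  by rewrite (le_trans (ler_wpM2r _ (ler_norm M)))// ler_wpM2l.
exists P, N0; split=> //.
- apply: (complete_system_eq0 phic) => [|i]; last first.
    by rewrite linear_funB// liftK ?subrr.
  have [lP [D PD]] := Pbl; split=> [a x y|]; first by rewrite lP lG.
  by exists (K * D) => x; rewrite (le_trans (GK _))// -mulrA ler_pM2l.
- by move=> v Gv; rewrite /P Gv linear_fun0// subr0.
- move=> N v N0N vN; rewrite /P -scaleN1r addrC; apply: span_upto_linear => //.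
  apply: (subset_span_upto N0N); apply: big_ind => [|x y|i _].
  + exact: span_upto0.
  + exact: span_uptoD.
  + exact/span_uptoZ/span_upto_mem.
Qed.

End KernelProjection.

(** * Upper semicontinuity, and minimizing sequences from finite dimension *)

Section Continuity.
Context {R : realType}.

(** By Baire, g is bounded above on some ball with center x0 and radius r, for
    otherwise the open sets where n < g would all be dense with empty
    intersection. Convexity transports the bound to a ball around v (through
    the reflection z = 2 v - x0 of x0), and then on the segments that issue from
    v it bounds the growth of g by t * (C - g v) at the fraction t. *)
Lemma convex_lsc_usc (V : completeNormedModType R) (g : V -> R) :
  (forall t x y, 0 <= t <= 1 ->
    g (t *: x + (1 - t) *: y) <= t * g x + (1 - t) * g y) ->
  (forall a, open [set x | a < g x]) ->
  forall v e, 0 < e -> \forall w \near v, g w < g v + e.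
Proof.
move=> gconv glsc v e e0; pose O (n : nat) := [set x | n%:R < g x].
have [n /denseNE[A [[x0 Ax0] An]]] : exists n, ~ dense (O n).
  apply: contrapT => /forallNP Odense.
  have [| | |x [_ Ox]] := @Baire _ V O _ setT.
  - by move=> n; split; [exact: glsc|exact: contrapT].
  - by exists 0.
  - exact: openT.
  have := Ox (Num.truncn (g x)).+1 I; rewrite /O /= ltNge => /negP; apply.
  by rewrite ltW// truncnS_gt.
have /nbhs_ballP[r /= r0 bA] := open_nbhs_nbhs Ax0.
have gn x : `|x - x0| < r -> g x <= n%:R.
  move=> xr; rewrite leNgt; apply/negP => gx.
  suff : (A `&` O n) x by rewrite An.
  by split=> //; apply: bA; rewrite -ball_normE /ball_/= distrC.
pose z := v + (v - x0); pose C := 2^-1 * n%:R + (1 - 2^-1) * g z.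
have gC h : `|h| < r / 2 -> g (v + h) <= C.
  move=> hr; have -> : v + h = 2^-1 *: (x0 + 2 *: h) + (1 - 2^-1) *: z.
    rewrite (_ : 1 - 2^-1 = 2^-1 :> R); last by field.
    have -> : z = 2 *: v - x0 by rewrite /z addrA scaler_nat mulr2n.
    rewrite -scalerDr (addrC x0) addrACA subrr addr0 addrC -scalerDr.
    by rewrite scalerA mulVf ?pnatr_eq0// scale1r.
  rewrite (le_trans (gconv _ _ _ _))//; first by lra.
  rewrite lerD2r ler_wpM2l ?invr_ge0// gn// addrAC subrr add0r normrZ.
  by rewrite gtr0_norm//; lra.
pose D := `|C - g v| + 1; pose t := Num.min 1 (e / (2 * D)).
have D0 : 0 < D by rewrite /D ltr_wpDl.
have t0 : 0 < t by rewrite lt_min ltr01 divr_gt0// mulr_gt0.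
have t1 : t <= 1 by rewrite ge_min lexx.
have tD : t * D < e.
  have : t <= e / (2 * D) by rewrite ge_min lexx orbT.
  rewrite ler_pdivlMr ?mulr_gt0// => tD; have : 0 < t * D by rewrite mulr_gt0.
  by move: tD; rewrite mulrCA; lra.
apply/nbhs_ballP; exists (t * (r / 2)) => /=; first by rewrite !mulr_gt0 ?invr_gt0.
move=> w; rewrite -ball_normE /ball_/= distrC => vw.
have -> : w = t *: (v + t^-1 *: (w - v)) + (1 - t) *: v.
  rewrite scalerDr scalerA mulfV ?gt_eqF// scale1r addrAC -scalerDl.
  by rewrite [t + _]addrC subrK scale1r addrC subrK.
have : g (v + t^-1 *: (w - v)) <= C.
  by apply: gC; rewrite normrZ gtr0_norm ?invr_gt0// mulrC ltr_pdivrMr// mulrC.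
move=> gwC; rewrite (le_lt_trans (gconv _ _ _ _))//; first by rewrite ltW.
have : C - g v <= D by rewrite /D (le_trans (ler_norm _))// lerDl.
by move: tD; nra.
Qed.

Context {U : completeNormedModType R} (J : U -> R) (W : set U).

(** Gateaux differentiability alone does not make J continuous; it only makes J
    lower semicontinuous on W through the gradient inequality, and convexity does
    the rest. Composing with a map P onto W replaces W by the whole Banach
    space, where Baire is available. *)
Lemma convex_gateaux_usc (P : U -> U) :
  gateaux_differentiable J -> convex_on J W -> bounded_linear P ->
  (forall v, W (P v)) ->
  forall v e, 0 < e -> \forall w \near v, J (P w) < J (P v) + e.
Proof.
move=> Jdiff Jconv Pbl WP; have [lP _] := Pbl.
have [M M0 PM] := bounded_linear_pos Pbl.
apply: (@convex_lsc_usc U (J \o P)) => [t x y t01|a] /=.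
  rewrite linear_funD// !(linear_funZ _ _ lP).
  exact: (convex_onP Jconv t01 (WP x) (WP y)).
rewrite openE => x /= ax; have [f fE] := gateaux_dual (P x) Jdiff.
pose K := `|f| * M + 1; have K0 : 0 < K.
  by rewrite ltr_wpDl// mulr_ge0// ltW.
apply/nbhs_ballP; exists ((J (P x) - a) / K) => /=.
  by rewrite divr_gt0// subr_gt0.
move=> y; rewrite -ball_normE /ball_/= distrC ltr_pdivlMr// => xy.
have := gradient_inequality Jconv ((Jdiff (P x)).1 (P y - P x)) (WP x) (WP y).
rewrite -fE -linear_funB//; apply: lt_le_trans.
have : `|f (P (y - x))| <= K * `|y - x|.
  rewrite (le_trans (dual_normP f _))//.
  rewrite (le_trans (ler_wpM2l (dual_norm_ge0 f) (PM _)))// mulrA.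
  by rewrite ler_wpM2r// lerDl.
by rewrite ler_norml; move: xy; rewrite mulrC; lra.
Qed.

End Continuity.

(** Approximate v in the kernel by w in a span; the projection P w is still close
    to P v = v, and lies in the span and in the kernel. So the minimum over the
    N-th subspace is, for large N, at most J (P w), which is close to J v. *)
Lemma galerkin_minimizing (R : realType) (U : completeNormedModType R)
    (J : U -> R) (s : nat) (Gamma : U -> 'rV[R]_s) (phi : nat -> U)
    (u_ : nat -> U) :
  let U0 := [set u | Gamma u = 0] in
  gateaux_differentiable J -> convex_on J U0 -> bounded_linear Gamma ->
  complete_system phi ->
  (forall N, is_minimizer J (span_upto phi N `&` U0) (u_ N)) ->
  minimizing_along J \oo U0 u_.
Proof.
move=> U0 Jdiff Jconv Gbl phic umin v e Gv e0.
have [P [N0 [Pbl GP Pid Pspan]]] := kernel_projection Gbl phic.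
have := convex_gateaux_usc Jdiff Jconv Pbl GP v e0.
move=> /nbhs_ballP[d /= d0 vd].
have [N1 [w [wN1 vw]]] := complete_systemP v phic d0.
have := vd w; rewrite -ball_normE (Pid v Gv) => /(_ vw) JPw.
exists (maxn N0 N1) => // N /=; rewrite geq_max => /andP[N0N N1N].
apply: le_lt_trans JPw; have [_] := umin N; apply; split=> //.
exact/Pspan/(subset_span_upto N1N).
Qed.

(** * Weakly convergent subsequences *)

Section Separation.
Context {R : realType} {U : normedModType R}.

(** The supremum of |f x| over the unit ball of the dual is the norm of the
    evaluation at x; the functional f reaches at least half of it. It is
    the norm of the evaluation, rather than that of x, that detects whether all
    functionals vanish at x. *)
Lemma almost_norming_functional (x : U) : exists f : dual U,
  `|f| <= 1 /\ forall g : dual U, `|g x| <= 2 * `|g| * `|f x|.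
Proof.
have [ev evE] : exists ev : dual (dual U), forall f, ev f = f x.
  apply: (@bounded_linear_dual R (dual U) (fun f => f x)).
  split; first by move=> a f g.
  by exists `|x| => f; rewrite mulrC; exact: dual_normP.
have [ev0|ev0] := eqVneq `|ev| 0.
  exists 0; rewrite normr0; split=> // g.
  by rewrite -evE (le_trans (dual_normP ev g))// [dual_norm _]ev0 mul0r !mulr_ge0.
have evpos : 0 < `|ev| by rewrite lt_neqAle eq_sym ev0 normr_ge0.
have [_ [f /= f1 <-]] :=
  sup_adherent (divr_gt0 evpos (ltr0Sn _ 1)) (dual_norm_has_sup ev).
rewrite evE -[sup _]/(`|ev|) => evf; exists f; split=> // g.
rewrite -evE (le_trans (dual_normP ev g))// mulrAC ler_wpM2r//.
by rewrite -[dual_norm _]/(`|ev|); lra.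
Qed.

Context (phi : nat -> U).

Let rat_comb (q : seq rat) := \sum_(i < size q) ratr q`_i *: phi i.

Let rat_comb_dense N (a : nat -> R) e : 0 < e ->
  exists2 q, size q = N & `|\sum_(i < N) a i *: phi i - rat_comb q| < e.
Proof.
elim: N => [|N IHN] in e * => e0.
  by exists [::] => //; rewrite /rat_comb !big_ord0 subrr normr0.
have [q qN qe] := IHN (e / 2) (divr_gt0 e0 (ltr0Sn _ 1)).
pose d := e / 2 / (`|phi N| + 1).
have phi0 : 0 < `|phi N| + 1 by rewrite ltr_wpDl.
have d0 : 0 < d by rewrite !divr_gt0.
have [r] : exists r : rat, ratr r \in `](a N - d), (a N + d)[.
  by apply: rat_in_itvoo; lra.
rewrite in_itv/= => rd; exists (rcons q r); first by rewrite size_rcons qN.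
have -> : rat_comb (rcons q r) = rat_comb q + ratr r *: phi N.
  rewrite /rat_comb size_rcons big_ord_recr/= nth_rcons ltnn eqxx qN.
  by congr (_ + _); apply: eq_bigr => i _; rewrite nth_rcons qN ltn_ord.
rewrite big_ord_recr/= opprD addrACA -scalerBl.
rewrite (le_lt_trans (ler_normD _ _))// [ltRHS](splitr e) ltr_leD//.
rewrite normrZ (@le_trans _ _ (d * (`|phi N| + 1)))//.
  by rewrite ler_pM// ?lerDl// ler_norml; move: rd; lra.
by rewrite divfK ?gt_eqF.
Qed.

(** Take an almost norming functional for each element of a countable dense
    set, the combinations of the phi i with rational coefficients. If all of them
    vanish at u, then the evaluation at u has norm at most 3 |u - x| for each x
    in the dense set, so it is zero. *)
Lemma countable_separating_family : complete_system phi ->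
  exists f_ : nat -> dual U,
    forall u, (forall n, f_ n u = 0) -> forall f : dual U, f u = 0.
Proof.
move=> phic.
pose x n := rat_comb (odflt [::] (unpickle n)).
have /choice[f_ fP] := fun n => almost_norming_functional (x n).
exists f_ => u fu f; apply/eqP; rewrite -normr_le0.
apply/ler_addgt0Pl => e e0; rewrite addr0.
pose d := e / (3 * (`|f| + 1)).
have f0 : 0 < `|f| + 1 by rewrite ltr_wpDl.
have d0 : 0 < d by rewrite divr_gt0// mulr_gt0.
have [N [_ [[a _ <-] vw]]] := complete_systemP u phic (divr_gt0 d0 (ltr0Sn _ 1)).
have [q _ qd] := rat_comb_dense N a (divr_gt0 d0 (ltr0Sn _ 1)).
have [n xn] : exists n, x n = rat_comb q.
  by exists (pickle q); rewrite /x pickleK.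
have uxd : `|u - x n| < d.
  rewrite xn -(subrK (\sum_(i < N) a i *: phi i) u) -addrA.
  by rewrite (le_lt_trans (ler_normD _ _))// [ltRHS](splitr d) ltrD.
have [f1 fx] := fP n.
have fnx : `|f_ n (x n)| <= `|u - x n|.
  have -> : f_ n (x n) = - f_ n (u - x n) by rewrite dualB fu sub0r opprK.
  rewrite normrN (le_trans (dual_normP _ _))//.
  by rewrite ler_piMl.
have fux : `|f (u - x n)| <= `|f| * `|u - x n| := dual_normP f _.
have -> : f u = f (u - x n) + f (x n) by rewrite dualB subrK.
rewrite (le_trans (ler_normD _ _))//.
have dE : d * (3 * (`|f| + 1)) = e by rewrite divfK// gt_eqF// mulr_gt0.
have := fx f; have := normr_ge0 (f : dual U).
by nra.
Qed.

End Separation.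

(** Choose Nk so that each functional f_ n of a countable separating family
    converges to f_ n u along the subsequence; this is possible since finitely
    many conditions hold on an element of G, which is an infinite set. All weak
    limits of the subsequence along ultrafilters then agree with u on the
    separating family, hence on all functionals, so the whole subsequence
    converges weakly to u. *)
Lemma reflexive_weak_subsequence (R : realType) (U : normedModType R)
    (phi : nat -> U) (u_ : nat -> U) (r : R) (G : set_system nat) (u : U) :
  reflexive_space U -> complete_system phi ->
  (forall k, `|u_ k| <= r) ->
  UltraFilter G -> \oo `<=` G -> weak_cvg_along G u_ u ->
  exists2 Nk : nat -> nat, increasing_seq Nk & weak_cvg (u_ \o Nk) u.
Proof.
move=> Urefl phic ur GU ooG uu.
have [f_ fsep] := countable_separating_family phic.
have near_u j m : \forall k \near G,
    forall n, (n <= m)%N -> `|f_ n u - f_ n (u_ k)| < j.+1%:R^-1.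
  elim: m => [|m IHm].
    have /cvgrPdist_lt/(_ j.+1%:R^-1) := uu (f_ 0%N).
    rewrite invr_gt0 ltr0n => /(_ isT); apply: filterS => k fk n.
    by rewrite leqn0 => /eqP ->.
  have /cvgrPdist_lt/(_ j.+1%:R^-1) := uu (f_ m.+1).
  rewrite invr_gt0 ltr0n => /(_ isT); apply: filterS2 IHm => k km fk n.
  by rewrite leq_eqVlt => /predU1P[->//|]; exact: km.
have /choice[next nextP] : forall p : nat * nat, exists k, (p.2 < k)%N /\
    forall n, (n <= p.1)%N -> `|f_ n u - f_ n (u_ k)| < p.1.+1%:R^-1.
  move=> [j m]; have Gm : \forall k \near G, (m < k)%N.
    by apply: ooG; exists m.+1.
  by have [k [mk fk]] := filter_ex (filterI Gm (near_u j j)); exists k.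
(* next (j, m) is an index beyond m that is good to precision 1 / (j + 1) for the
   functionals f_ 0, ..., f_ j. *)
pose Nk := fix Nk j := if j is i.+1 then next (j, Nk i) else next (0, 0)%N.
have NkS j : (Nk j < Nk j.+1)%N by have [] := nextP (j.+1, Nk j).
have Nkf n j : (n <= j)%N -> `|f_ n u - f_ n (u_ (Nk j))| < j.+1%:R^-1.
  case: j => [|j] nj; first by have [_] := nextP (0, 0)%N; apply.
  by have [_] := nextP (j.+1, Nk j); apply.
exists Nk; first by apply/increasing_seqP.
move=> f; apply: cvg_along_ultra => H HU ooH.
have [|v vP] := @reflexive_ultra_weak_cvg R U H (u_ \o Nk) r Urefl HU.
  by apply: (@filterE _ H) => k /=.
suff -> : f u = f v by exact: vP.
apply/eqP; rewrite -subr_eq0 -dualB; apply/eqP; apply: fsep => n.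
rewrite dualB; apply/eqP; rewrite subr_eq0; apply/eqP.
have fnu : f_ n (u_ (Nk j)) @[j --> H] --> f_ n u.
  apply/cvgrPdist_lt => e e0; apply: ooH.
  near=> j; rewrite (lt_trans (Nkf n j _))//.
  - by near: j; exists n.
  - by near: j; exact: (near_infty_natSinv_lt (PosNum e0)).
exact: (norm_cvg_unique fnu (vP (f_ n))).
Unshelve. all: by end_near. Qed.

(** * The approximation theorem *)

Section WeakLimits.
Context {R : realType} {U : normedModType R}.

Lemma cvg_weak_cvg_along (G : set_system nat) (w : nat -> U) (u : U) :
  Filter G -> w @ G --> u -> weak_cvg_along G w u.
Proof.
move=> GF /cvgrPdist_lt wu f; apply/cvgrPdist_lt => e e0.
have f0 : 0 < `|f| + 1 by rewrite ltr_wpDl.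
have := wu _ (divr_gt0 e0 f0); apply: filterS => k.
rewrite ltr_pdivlMr// -dualB; apply: le_lt_trans.
by rewrite (le_trans (dual_normP f _))// mulrC ler_wpM2l// lerDl.
Qed.

(** The coordinates of Gamma are elements of the dual. *)
Lemma kernel_weakly_closed (s : nat) (Gamma : U -> 'rV[R]_s)
    (G : set_system nat) (w : nat -> U) (u : U) :
  bounded_linear Gamma -> ProperFilter G -> (forall k, Gamma (w k) = 0) ->
  weak_cvg_along G w u -> Gamma u = 0.
Proof.
move=> [lG [M GM]] GF Gw wu; apply/rowP => j.
have [f fE] : exists f : dual U, forall x, f x = Gamma x 0 j.
  apply: (@bounded_linear_dual R U (fun x => Gamma x 0 j)).
  split=> [a x y|]; first by rewrite lG !mxE.
  exists M => x; apply: le_trans (GM x); exact: coord_le_norm.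
rewrite -fE mxE; apply: norm_cvg_unique (wu f) _.
rewrite (_ : (fun n => f (w n)) = cst 0); first exact: cvg_cst.
by apply/funext => k; rewrite fE Gw mxE.
Qed.

End WeakLimits.

(** The midpoint of two distinct minimizers would do better. *)
Lemma strictly_convex_minimizer_unique (R : realType) (U : normedModType R)
    (J : U -> R) (W V : set U) (u v : U) :
  strictly_convex_on J W -> V `<=` W ->
  (forall x y, V x -> V y -> V (2^-1 *: x + (1 - 2^-1) *: y)) ->
  is_minimizer J V u -> is_minimizer J V v -> u = v.
Proof.
move=> Jstrict VW Vmid [Vu umin] [Vv vmin]; apply: contrapT => /eqP uv.
have := Jstrict 2^-1 u v _ (VW _ Vu) (VW _ Vv) uv.
have -> : 0 < (2^-1 : R) < 1 by lra.
have := umin _ (Vmid _ _ Vu Vv); have := umin _ Vv; have := vmin _ Vu.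
by move=> ? ? ? /(_ isT); lra.
Qed.

Theorem theorem1 (R : realType) (U : completeNormedModType R)
    (J : U -> R) (s : nat) (Gamma : U -> 'rV[R]_s) (phi : nat -> U) :
  let U0 : set U := [set u | Gamma u = 0] in
  let U0N (N : nat) : set U := span_upto phi N `&` U0 in
  reflexive_space U ->
  gateaux_differentiable J ->
  bounded_linear Gamma ->
  complete_system phi ->
  convex_on J U0 ->
  grows_at_infinity J U0 ->
  [/\ exists ubar : U, is_minimizer J U0 ubar,
      forall N : nat, exists uN : U, is_minimizer J (U0N N) uN,
      forall u_ : nat -> U, (forall N : nat, is_minimizer J (U0N N) (u_ N)) ->
        exists (ubar : U) (Nk : nat -> nat),
          [/\ is_minimizer J U0 ubar,
              increasing_seq Nk,
              weak_cvg (u_ \o Nk) ubar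
            & J (u_ (Nk k)) @[k --> \oo] --> J ubar]
    & strictly_convex_on J U0 ->
        [/\ exists! ubar : U, is_minimizer J U0 ubar,
            forall N : nat, exists! uN : U, is_minimizer J (U0N N) uN
          & forall (ubar : U) (u_ : nat -> U),
              is_minimizer J U0 ubar ->
              (forall N : nat, is_minimizer J (U0N N) (u_ N)) ->
              weak_cvg u_ ubar /\ J (u_ N) @[N --> \oo] --> J ubar]].
Proof.
move=> U0 U0N Urefl Jdiff Gbl phic Jconv Jgrows.
have [lG _] := Gbl.
have U00 : U0 0 by exact: linear_fun0.
have U0lin a b x y : U0 x -> U0 y -> U0 (a *: x + b *: y).
  by rewrite /U0 /= => Gx Gy; rewrite lG linear_funZ// Gx Gy !scaler0 addr0.
have U0N0 N : U0N N 0 by split=> //; exact: span_upto0.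
have U0NU0 N : U0N N `<=` U0 by move=> ? [].
have U0Nlin N a b x y : U0N N x -> U0N N y -> U0N N (a *: x + b *: y).
  move=> [xN x0] [yN y0]; split; last exact: U0lin.
  by apply: span_upto_linear => //; exact: span_uptoZ.
have exU0 : exists ubar, is_minimizer J U0 ubar.
  apply: (exists_minimizer Jdiff Jconv Jgrows) => //; first by exists 0.
  move=> G w r GU U0w wr.
  have [u wu] := reflexive_ultra_weak_cvg Urefl GU wr.
  by exists u => //; exact: kernel_weakly_closed wu.
have exU0N N : exists uN, is_minimizer J (U0N N) uN.
  apply: (exists_minimizer Jdiff Jconv Jgrows) => //; first by exists 0.
  move=> G w r GU wN wr.
  have [u uN wu] := span_upto_ultra_cvg GU (fun k => (wN k).1) wr.
  have {}wu : weak_cvg_along G w u by exact: cvg_weak_cvg_along.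
  exists u => //; split=> //.
  exact: kernel_weakly_closed Gbl _ (fun k => (wN k).2) wu.
have ultra_minimizer u_ G u : (forall N, is_minimizer J (U0N N) (u_ N)) ->
    UltraFilter G -> \oo `<=` G -> weak_cvg_along G u_ u ->
    is_minimizer J U0 u.
  move=> umin GU ooG uu.
  have U0u_ k : U0 (u_ k) by have [[]] := umin k.
  have U0u : U0 u by exact: kernel_weakly_closed uu.
  split=> //; apply: (minimizing_weak_limit _ Jdiff Jconv _ _ U0u uu).
    exact: (@filterE _ G).
  by apply: (minimizing_alongS ooG); exact: galerkin_minimizing umin.
have bounded u_ : (forall N, is_minimizer J (U0N N) (u_ N)) ->
    exists r, forall N, `|u_ N| <= r.
  move=> umin; have [r rP] := Jgrows (J 0 + 1).
  exists r => N; have [[_ U0u] uN] := umin N.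
  rewrite leNgt; apply/negP => /ltW/(rP _ U0u).
  by rewrite leNgt (le_lt_trans (uN _ (U0N0 N)))// ltrDl.
have values u_ ubar : (forall N, is_minimizer J (U0N N) (u_ N)) ->
    is_minimizer J U0 ubar -> J (u_ N) @[N --> \oo] --> J ubar.
  move=> umin [U0ubar ubarmin]; apply/cvgrPdist_lt => e e0.
  have := galerkin_minimizing Jdiff Jconv Gbl phic umin U0ubar e0.
  apply: filterS => N uNe; have := ubarmin _ (U0NU0 N _ (umin N).1).
  by rewrite ltr_norml; lra.
split=> // [u_ umin|Jstrict].
  have [r ur] := bounded u_ umin.
  have [G [GU ooG]] := ultraFilterLemma (_ : ProperFilter (\oo : set_system nat)).
  have [|u uu] := @reflexive_ultra_weak_cvg R U G u_ r Urefl GU.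
    exact: (@filterE _ G).
  have [Nk Nkinc Nku] := reflexive_weak_subsequence Urefl phic ur GU ooG uu.
  have ubar := ultra_minimizer _ _ _ umin GU ooG uu.
  exists u, Nk; split=> //.
  apply: (cvg_comp Nk (J \o u_)) (values _ _ umin ubar).
  by apply/cvgnyPge => m; exists m => // k /= /leq_trans; apply; exact: unstable.mono_leq_infl.
have uniqU0 u v : is_minimizer J U0 u -> is_minimizer J U0 v -> u = v.
  by apply: (strictly_convex_minimizer_unique Jstrict) => // x y; exact: U0lin.
split.
- by have [u umin] := exU0; exists u; split=> // v; exact: uniqU0.
- move=> N; have [u umin] := exU0N N; exists u; split=> // v.
  apply: (strictly_convex_minimizer_unique Jstrict) umin => // x y.
  exact: U0Nlin.
move=> ubar u_ ubarmin umin; split; last exact: values.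
have [r ur] := bounded u_ umin.
move=> f; apply: cvg_along_ultra => G GU ooG.
have [|u uu] := @reflexive_ultra_weak_cvg R U G u_ r Urefl GU.
  exact: (@filterE _ G).
rewrite (uniqU0 ubar u ubarmin); first exact: uu.
exact: ultra_minimizer uu.
Qed.
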